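(* Let $B,C$ be real constants with $B \geq \max\left(\frac{3}{2},\, 1+\frac{C^2}{16R}\right)$ and let $x_0>1$. Assume that $A_\theta, B, C, x_0$ give an admissible asymptotic bound for $E_\theta$, i.e. $E_\theta(x)\le \varepsilon_{\theta,asymp}(x)$ for all $x\ge x_0$, where $$\varepsilon_{\theta,asymp}(x)=A_\theta\left(\frac{\log x}{R}\right)^B\exp\left(-C\sqrt{\frac{\log x}{R}}\right).$$ Let $$x_1 \geq \max\left\{x_0,\ \exp\left(\left(1+\frac{C}{2\sqrt{R}}\right)^2\right)\right\}$$ and define $$\mu_{asymp}(x_0,x_1)=\frac{x_0\log(x_1)}{\varepsilon_{\theta,asymp}(x_1)\,x_1\log(x_0)}\left|\frac{\pi(x_0)-\mathrm{Li}(x_0)}{x_0/\log(x_0)}-\frac{\theta(x_0)-x_0}{x_0}\right|+\frac{2D_+\left(\sqrt{\log(x_1)}-\frac{C}{2\sqrt{R}}\right)}{\sqrt{\log(x_1)}}.$$ Then $$E_\pi(x)\le \varepsilon_{\theta,asymp}(x)\left(1+\mu_{asymp}(x_0,x_1)\right)\quad\text{for all } x\ge x_1.$$ Consequently, with $A_\pi=(1+\mu_{asymp}(x_0,x_1))A_\theta$, the constants $A_\pi,B,C,x_1$ give an admissible asymptotic bound for $E_\pi$, i.e. $E_\pi(x)\le A_\pi\left(\frac{\log x}{R}\right)^B\exp\left(-C\sqrt{\frac{\log x}{R}}\right)$ for all $x\ge x_1$.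
   Context: $\pi(x)$ is the number of primes $p\le x$; $\theta(x)=\sum_{p\le x}\log p$ (sum over primes); $\mathrm{Li}(x)=\int_2^x\frac{dt}{\log t}$. The error terms are $E_\pi(x)=\left|\frac{\pi(x)-\mathrm{Li}(x)}{x/\log x}\right|$ and $E_\theta(x)=\left|\frac{\theta(x)-x}{x}\right|$. $R$ is any fixed positive constant such that the Riemann zeta function $\zeta(s)$ has no zeros in the region $\operatorname{Re}(s)\ge 1-\frac{1}{R\log \operatorname{Im}(s)}$, $\operatorname{Im}(s)\ge 3$. $D_+(x)=e^{-x^2}\int_0^x e^{t^2}\,dt$ is the Dawson function. *)

(* Defs.v *)
(* Stdlib reals with Coquelicot. *)
From Stdlib Require Import Reals ZArith Znumtheory.
From Coquelicot Require Import Coquelicot.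
Open Scope R_scope.

(* For [x < 0] the range degenerates to {0}, which contains no prime. *)
Definition sum_primes (f : R -> R) (x : R) : R :=
  sum_n (fun n => if prime_dec (Z.of_nat n) then f (INR n) else 0)
        (Z.to_nat (Int_part x)).

Definition prime_pi (x : R) : R := sum_primes (fun _ => 1) x.

Definition theta (x : R) : R := sum_primes ln x.

(* The integral is oriented: it is negative for 1 < x < 2. *)
Definition Li (x : R) : R := RInt (fun t => / ln t) 2 x.

Definition E_pi (x : R) : R := Rabs ((prime_pi x - Li x) / (x / ln x)).

Definition E_theta (x : R) : R := Rabs ((theta x - x) / x).

Definition dawson (x : R) : R := exp (- x ^ 2) * RInt (fun t => exp (t ^ 2)) 0 x.

Definition Cexp (z : C) : C := (exp (Re z) * cos (Im z), exp (Re z) * sin (Im z)).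

(* [zeta] is the analytic continuation to C \ {1} of the Dirichlet series
   sum_{n >= 1} n^{-s}; this determines it everywhere except at the pole 1,
   where its value is left arbitrary. *)
Definition is_riemann_zeta (zeta : C -> C) : Prop :=
  (forall s : C, 1 < Re s ->
     is_series (V := C_NormedModule)
       (fun n => Cexp (- s * RtoC (ln (INR (S n))))%C) (zeta s)) /\
  (forall s : C, s <> RtoC 1 ->
     ex_derive (K := C_AbsRing) (V := C_NormedModule) zeta s).

Definition zero_free_region (zeta : C -> C) (R0 : R) : Prop :=
  forall s : C,
    3 <= Im s -> 1 - 1 / (R0 * ln (Im s)) <= Re s -> zeta s <> RtoC 0.

Definition eps_asymp (R0 A B c x : R) : R :=
  A * Rpower (ln x / R0) B * exp (- c * sqrt (ln x / R0)).

Definition admissible_asymp (E : R -> R) (R0 A B c x0 : R) : Prop :=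
  forall x : R, x0 <= x -> E x <= eps_asymp R0 A B c x.

Definition mu_asymp (R0 A B c x0 x1 : R) : R :=
  x0 * ln x1 / (eps_asymp R0 A B c x1 * x1 * ln x0)
    * Rabs ((prime_pi x0 - Li x0) / (x0 / ln x0) - (theta x0 - x0) / x0)
  + 2 * dawson (sqrt (ln x1) - c / (2 * sqrt R0)) / sqrt (ln x1).

(* Main.v *)
Require Import Defs.
From Stdlib Require Import Reals Lra Lia ZArith Znumtheory List Bool.
From Coquelicot Require Import Coquelicot.
Open Scope R_scope.

(** Write [u = sqrt (ln x)], [a = c / (2 * sqrt R0)], [p = 2 * B - 3] and
    [N = A / R0 ^ B]. Partial summation amounts to the study of
    [gap x = prime_pi x - Li x - (theta x - x) / ln x], which is continuous on
    [x > 1], with derivative [(theta x - x) / (x * ln x ^ 2)] off the integers.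
    Since [E_pi x <= E_theta x + ln x / x * Rabs (gap x)], everything rests on
<<
      Rabs (gap x) <= Rabs (gap x0)
                      + 2 N exp (- a^2) u^p (integral of exp (v^2) over [0, u - a])
>>
    for [u >= 1 + a] ([gap_bound]). Multiplied by [ln x / x], the last term is
    [eps_asymp x * 2 * dawson (u - a) / u], and the theorem follows because
    [dawson] decreases on [w >= 1] ([dawson_decr]) and [x * eps_asymp x / ln x]
    increases ([main_term_incr], by [B >= 1 + c ^ 2 / (16 * R0)]).

    In the variable [s = sqrt (ln t)] the hypothesis on [theta] bounds the
    increments of [gap] by the integral of the weight [s ^ p * exp ((s - a) ^ 2)]
    ([gap_increment_weight]). If the path starts at [s >= a], then [s ^ p <= u ^ p]
    gives the claim at once ([gap_growth_right]). For a path starting at some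
    [s < a] the same estimate would add an integral of [exp (v ^ 2)] over negative
    [v], for which the Dawson term leaves no room. Two facts deal with this case.

    First, [theta t <= t] for [t <= 32], so [gap] decreases on [(1, 32]], and
    [gap 32 >= 0]. Hence a starting point [x0 < 32] may be moved up to the smaller
    of 32 and [exp (a ^ 2)] without increasing [Rabs (gap x0)]
    ([gap_decr_small], [gap_32_nonneg]).

    Second, a path starting at [s >= b = 93 / 50], a number just below
    [sqrt (ln 32)], with [s < a], recovers the loss made before [a] by the time it
    reaches [1 + a] ([gap_growth_left]). Indeed [p >= a ^ 2 / 2 - 1] makes the
    weight on [[b, a]] at most [a ^ p * exp (- k * (a - s))] for an explicit
    [k > 0] ([weight_le_exp]), whereas on [[a, 1 + a]] the power [s ^ p] is
    smaller than [(1 + a) ^ p] by a definite amount. The comparison of the two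
    ([loss_le_gain], [loss_le_taylor]) is tight, and fails if 32 is replaced by a
    much smaller number, since [b] then decreases. *)

(** * Calculus and elementary inequalities *)

Lemma nondecr_of_derive_nonneg (f df : R -> R) (a b : R) :
  a <= b ->
  (forall x, a <= x <= b -> is_derive f x (df x)) ->
  (forall x, a < x < b -> 0 <= df x) ->
  f a <= f b.
Proof.
  intros Hab Hd Hpos.
  destruct (Req_dec a b) as [->|Hne]; [lra|].
  destruct (MVT_cor2 f df a b) as [c [Hc1 Hc2]]; [lra| |].
  - intros c Hc. apply is_derive_Reals, Hd, Hc.
  - specialize (Hpos c Hc2).
    assert (0 <= df c * (b - a)) by (apply Rmult_le_pos; lra). lra.
Qed.

Lemma exp_le (x y : R) : x <= y -> exp x <= exp y.
Proof.
  intros [H|H]; [left; apply exp_increasing, H|right; f_equal; exact H].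
Qed.

Lemma ln_le_sub_one (z : R) : 0 < z -> ln z <= z - 1.
Proof.
  intros Hz. generalize (exp_ineq1_le (ln z)). rewrite exp_ln by exact Hz. lra.
Qed.

Lemma ln_sub_ge_pade (s u : R) :
  0 < s -> s <= u -> 2 * (u - s) / (u + s) <= ln u - ln s.
Proof.
  intros Hs Hsu.
  pose (f := fun x => ln x - ln s - 2 * (x - s) / (x + s)).
  assert (H : f s <= f u).
  { apply (nondecr_of_derive_nonneg f (fun x => (x - s) ^ 2 / (x * (x + s) ^ 2)));
      [exact Hsu| |].
    - intros x Hx. unfold f. auto_derive; [lra|]. field. lra.
    - intros x Hx. apply Rle_div_r; [|nra].
      apply Rmult_lt_0_compat; [lra|]. nra. }
  unfold f in H. replace (s - s) with 0 in H by ring.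
  unfold Rdiv in H. rewrite Rmult_0_r, Rmult_0_l in H. unfold Rdiv. lra.
Qed.

Lemma exp_ge_cubic (x : R) :
  0 <= x -> 1 + x + x ^ 2 / 2 + x ^ 3 / 6 <= exp x.
Proof.
  intros Hx. generalize (exp_ge_taylor x 3 Hx). simpl. lra.
Qed.

Lemma one_minus_exp_le_pade (y : R) :
  0 <= y -> 1 - exp (- y) <= 2 * y / (2 + y).
Proof.
  intros Hy.
  assert (H2 : 0 < 2 + y) by lra.
  assert (He : exp (- y) * exp y = 1)
    by (rewrite <- exp_plus, Rplus_opp_l; apply exp_0).
  assert (Hp : 0 < exp (- y)) by apply exp_pos.
  apply Rle_div_r; [exact H2|].
  destruct (Rle_dec 2 y) as [H|H]; [nra|].
  (* The Pade bound for the logarithm, at [exp y] against 1, bounds [exp y] above. *)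
  assert (Hq : 1 <= exp y) by (generalize (exp_ineq1_le y); lra).
  assert (Hl := ln_sub_ge_pade 1 (exp y) Rlt_0_1 Hq).
  rewrite ln_exp, ln_1, Rminus_0_r in Hl.
  apply Rle_div_l in Hl; [|lra].
  nra.
Qed.

(** Convexity of [exp]: [p * ln y] is an average of [ln y] and 0. *)
Lemma Rpower_bernoulli_le (y p : R) :
  0 < y -> 0 <= p <= 1 -> Rpower y p <= 1 + p * (y - 1).
Proof.
  intros Hy Hp.
  assert (Hm := exp_pos (p * ln y)).
  unfold Rpower.
  (* Tangents of [exp] at [p * ln y], evaluated at [ln y] and at 0. *)
  assert (H1 : exp (p * ln y) * (1 + (ln y - p * ln y)) <= y).
  { rewrite <- (exp_ln y Hy) at 4.
    replace (ln y) with (p * ln y + (ln y - p * ln y)) at 4 by ring.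
    rewrite exp_plus. apply Rmult_le_compat_l; [lra|apply exp_ineq1_le]. }
  assert (H0 : exp (p * ln y) * (1 + - (p * ln y)) <= 1).
  { apply Rle_trans with (exp (p * ln y) * exp (- (p * ln y))).
    - apply Rmult_le_compat_l; [lra|apply exp_ineq1_le].
    - rewrite <- exp_plus, Rplus_opp_r, exp_0. lra. }
  nra.
Qed.

Lemma Rpower_bernoulli_ge (y p : R) :
  0 < y -> 1 <= p -> 1 + p * (y - 1) <= Rpower y p.
Proof.
  intros Hy Hp.
  assert (H : Rpower (Rpower y p) (/ p) <= 1 + / p * (Rpower y p - 1)).
  { apply Rpower_bernoulli_le; [apply exp_pos|].
    split; [left; apply Rinv_0_lt_compat; lra|].
    rewrite <- Rinv_1. apply Rinv_le_contravar; lra. }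
  rewrite Rpower_mult, Rinv_r, Rpower_1 in H by lra.
  apply (Rmult_le_compat_l p) in H; [|lra].
  replace (p * (1 + / p * (Rpower y p - 1)))
    with (p + (Rpower y p - 1)) in H by (field; lra).
  lra.
Qed.

Lemma is_derive_Rpower (p x : R) :
  0 < x -> is_derive (fun s => Rpower s p) x (p * Rpower x (p - 1)).
Proof. intros Hx. apply is_derive_Reals, derivable_pt_lim_power, Hx. Qed.

Lemma Rpower_ge_0 (x p : R) : 0 <= Rpower x p.
Proof. left; apply exp_pos. Qed.

(** Bernoulli's inequality at [a / s] and [u / s], averaged with the weights that
    express [s] through [a] and [u]. *)
Lemma Rpower_le_chord (a u s p : R) :
  0 < a -> a <= s <= u -> a < u -> 1 <= p ->
  Rpower s p <=
  Rpower u p * (1 - (u - s) / (u - a) * (1 - Rpower (a / u) p)).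
Proof.
  intros Ha Hs Hau Hp.
  assert (B1 := Rpower_bernoulli_ge (a / s) p).
  assert (B2 := Rpower_bernoulli_ge (u / s) p).
  assert (E : forall t, 0 < t -> Rpower t p = Rpower s p * Rpower (t / s) p).
  { intros t Ht. rewrite Rpower_mult_distr; [|lra|apply Rdiv_lt_0_compat; lra].
    f_equal. field. lra. }
  assert (Ha' : Rpower u p * Rpower (a / u) p = Rpower a p).
  { rewrite Rpower_mult_distr; [|lra|apply Rdiv_lt_0_compat; lra].
    f_equal. field. lra. }
  set (w := (u - s) / (u - a)).
  replace (Rpower u p * (1 - w * (1 - Rpower (a / u) p)))
    with ((1 - w) * Rpower u p + w * (Rpower u p * Rpower (a / u) p)) by ring.
  rewrite Ha', (E a), (E u) by lra.
  assert (Hw : 0 <= w <= 1).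
  { unfold w. split; [apply Rle_div_r; lra|apply Rle_div_l; lra]. }
  assert (Hw2 : (1 - w) * (u / s) + w * (a / s) = 1) by (unfold w; field; lra).
  assert (Hsp := Rpower_ge_0 s p).
  assert (B1' : 1 + p * (a / s - 1) <= Rpower (a / s) p)
    by (apply B1; [apply Rdiv_lt_0_compat; lra|lra]).
  assert (B2' : 1 + p * (u / s - 1) <= Rpower (u / s) p)
    by (apply B2; [apply Rdiv_lt_0_compat; lra|lra]).
  assert (K1 := Rmult_le_compat_l w _ _ (proj1 Hw) B1').
  assert (K2 : (1 - w) * (1 + p * (u / s - 1)) <= (1 - w) * Rpower (u / s) p)
    by (apply Rmult_le_compat_l; lra).
  assert (K : 1 <= (1 - w) * Rpower (u / s) p + w * Rpower (a / s) p).
  { apply Rle_trans with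
      ((1 - w) * (1 + p * (u / s - 1)) + w * (1 + p * (a / s - 1))); [|lra].
    right. transitivity (1 + p * (((1 - w) * (u / s) + w * (a / s)) - 1)).
    - rewrite Hw2. ring.
    - ring. }
  assert (K3 := Rmult_le_compat_l _ _ _ Hsp K). lra.
Qed.

Lemma Rpower_le_tangent (u s p : R) :
  0 < s -> s <= u -> 0 <= p <= 1 ->
  Rpower s p <= Rpower u p * (1 - (u - s) * (p / u)).
Proof.
  intros Hs Hsu Hp.
  replace (Rpower s p) with (Rpower u p * Rpower (s / u) p).
  2:{ rewrite Rpower_mult_distr; [|lra|apply Rdiv_lt_0_compat; lra].
      f_equal. field. lra. }
  apply Rmult_le_compat_l; [apply Rpower_ge_0|].
  apply Rle_trans with (1 := Rpower_bernoulli_le (s / u) p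
    ltac:(apply Rdiv_lt_0_compat; lra) Hp).
  right. field. lra.
Qed.

(** * The integral of [exp (t ^ 2)] and the Dawson function *)

Definition expsq_int (v : R) : R := RInt (fun t => exp (t ^ 2)) 0 v.

Lemma is_derive_expsq_int (v : R) : is_derive expsq_int v (exp (v ^ 2)).
Proof.
  assert (C : forall x, continuous (fun t => exp (t ^ 2)) x).
  { intros x. apply (ex_derive_continuous (fun t => exp (t ^ 2))).
    auto_derive. exact I. }
  apply (is_derive_RInt (fun t => exp (t ^ 2)) _ 0).
  - apply filter_forall. intros x.
    apply (RInt_correct (V := R_CompleteNormedModule)).
    apply (ex_RInt_continuous (V := R_CompleteNormedModule)). intros; apply C.
  - apply C.
Qed.

Lemma expsq_int_0 : expsq_int 0 = 0.
Proof. exact (RInt_point (V := R_CompleteNormedModule) 0 _). Qed.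

Lemma expsq_int_nonneg (v : R) : 0 <= v -> 0 <= expsq_int v.
Proof.
  intros Hv. rewrite <- expsq_int_0.
  apply (nondecr_of_derive_nonneg expsq_int (fun v => exp (v ^ 2))); [exact Hv| |].
  - intros; apply is_derive_expsq_int.
  - intros; left; apply exp_pos.
Qed.

(** The difference is the integral of [(1 - v) * exp (v ^ 2)] over [[0, 1]],
    and [exp (v ^ 2) >= 1 + v ^ 2 + v ^ 4 / 2] integrates to exactly 3/5. *)
Lemma expsq_int_1_ge : 3 / 5 <= expsq_int 1 - (exp 1 - 1) / 2.
Proof.
  pose (f := fun v => expsq_int v - (exp (v ^ 2) - 1) / 2
     - (v - v ^ 2 / 2 + v ^ 3 / 3 - v ^ 4 / 4 + v ^ 5 / 10 - v ^ 6 / 12)).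
  assert (H : f 0 <= f 1).
  { apply (nondecr_of_derive_nonneg f
      (fun v => (1 - v) * (exp (v ^ 2) - (1 + v ^ 2 + v ^ 4 / 2)))); [lra| |].
    - intros v _. unfold f.
      assert (D := is_derive_expsq_int v).
      evar_last.
      { apply @is_derive_minus; [apply @is_derive_minus; [exact D|]|];
          [auto_derive; [exact I|reflexivity]|auto_derive; [exact I|reflexivity]]. }
      unfold minus, plus, opp; simpl. field.
    - intros v Hv. apply Rmult_le_pos; [lra|].
      assert (K := exp_ge_cubic (v ^ 2) ltac:(nra)).
      assert (0 <= (v ^ 2) ^ 3) by (apply pow_le; nra). nra. }
  unfold f in H. rewrite expsq_int_0 in H.
  replace (0 ^ 2) with 0 in H by ring. rewrite exp_0 in H.
  replace (1 ^ 2) with 1 in H by ring. lra.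
Qed.

(** This says that [2 * w * dawson w >= 1], that is, that the derivative
    [1 - 2 * w * dawson w] of [dawson] is nonpositive. *)
Lemma expsq_int_ge (w : R) : 1 <= w -> exp (w ^ 2) / (2 * w) <= expsq_int w.
Proof.
  intros Hw.
  pose (f := fun v => expsq_int v - exp (v ^ 2) / (2 * v)).
  assert (H : f 1 <= f w).
  { apply (nondecr_of_derive_nonneg f
      (fun v => exp (v ^ 2) / (2 * v ^ 2))); [lra| |].
    - intros v Hv. unfold f.
      assert (D := is_derive_expsq_int v).
      evar_last.
      { apply @is_derive_minus; [exact D|].
        auto_derive; [lra|reflexivity]. }
      unfold minus, plus, opp; simpl. field. lra.
    - intros v Hv. apply Rlt_le, Rdiv_lt_0_compat; [apply exp_pos|nra]. }
  assert (G := expsq_int_1_ge).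
  unfold f in H. replace (1 ^ 2) with 1 in H by ring.
  lra.
Qed.

Lemma dawson_decr (w w' : R) : 1 <= w -> w <= w' -> dawson w' <= dawson w.
Proof.
  intros Hw Hww.
  pose (f := fun v => - (exp (- v ^ 2) * expsq_int v)).
  assert (H : f w <= f w').
  { apply (nondecr_of_derive_nonneg f
      (fun v => 2 * v * exp (- v ^ 2) * expsq_int v - 1)); [exact Hww| |].
    - intros v Hv. unfold f.
      assert (D := is_derive_expsq_int v).
      evar_last.
      { apply @is_derive_opp, @is_derive_mult; [|exact D|exact Rmult_comm].
        auto_derive; [exact I|reflexivity]. }
      unfold opp, plus, mult; simpl.
      assert (E : exp (- (v * (v * 1))) * exp (v * (v * 1)) = 1)
        by (rewrite <- exp_plus, Rplus_opp_l; apply exp_0).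
      rewrite E. ring.
    - intros v Hv.
      assert (G := expsq_int_ge v ltac:(lra)).
      apply Rle_div_l in G; [|lra].
      assert (E : exp (- v ^ 2) * exp (v ^ 2) = 1)
        by (rewrite <- exp_plus, Rplus_opp_l; apply exp_0).
      assert (P := exp_pos (- v ^ 2)). nra. }
  unfold f in H. unfold dawson. fold (expsq_int w) (expsq_int w'). lra.
Qed.

(** * The continuous potential of partial summation *)

(** The combination of [prime_pi] and [theta] produced by partial summation: at
    a prime, the jump of [prime_pi] and that of [theta / ln] cancel. *)
Definition gap (x : R) : R := prime_pi x - Li x - (theta x - x) / ln x.

Lemma ln_pos (x : R) : 1 < x -> 0 < ln x.
Proof. intros Hx. rewrite <- ln_1. apply ln_increasing; lra. Qed.

Lemma is_derive_Li (x : R) : 1 < x -> is_derive Li x (/ ln x).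
Proof.
  intros Hx.
  assert (C : forall t, 1 < t -> continuous (fun t => / ln t) t).
  { intros t Ht. apply (ex_derive_continuous (fun t => / ln t)).
    auto_derive. assert (H := ln_pos t Ht). lra. }
  apply (is_derive_RInt (fun t => / ln t) _ 2).
  - exists (mkposreal (x - 1) ltac:(lra)). intros y Hy.
    apply Rabs_def2 in Hy. simpl in Hy. unfold minus, plus, opp in Hy; simpl in Hy.
    apply (RInt_correct (V := R_CompleteNormedModule)).
    apply (ex_RInt_continuous (V := R_CompleteNormedModule)).
    intros z Hz. apply C.
    assert (1 < Rmin 2 y) by (apply Rmin_glb_lt; lra). lra.
  - apply C, Hx.
Qed.

Lemma sum_primes_floor (f : R -> R) (n : nat) (x : R) :
  INR n <= x < INR (S n) -> sum_primes f x = sum_primes f (INR n).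
Proof.
  assert (E : forall y, INR n <= y < INR (S n) -> Int_part y = Z.of_nat n).
  { intros y Hy. symmetry. apply Int_part_spec.
    rewrite <- INR_IZR_INZ. rewrite S_INR in Hy. lra. }
  intros Hx. unfold sum_primes. rewrite (E x Hx), (E (INR n)); [reflexivity|].
  rewrite S_INR. lra.
Qed.

Lemma sum_primes_S (f : R -> R) (n : nat) :
  sum_primes f (INR (S n)) =
  sum_primes f (INR n)
  + if prime_dec (Z.of_nat (S n)) then f (INR (S n)) else 0.
Proof.
  assert (E : forall m, Z.to_nat (Int_part (INR m)) = m).
  { intros m. rewrite <- (Int_part_spec (INR m) (Z.of_nat m)).
    - apply Nat2Z.id.
    - rewrite <- INR_IZR_INZ. lra. }
  unfold sum_primes. rewrite !E, sum_Sn. reflexivity.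
Qed.

Lemma gap_piece (n : nat) (x : R) :
  INR n <= x <= INR (S n) -> 1 < x ->
  gap x = prime_pi (INR n) - Li x - (theta (INR n) - x) / ln x.
Proof.
  intros Hx H1. assert (L := ln_pos x H1). unfold gap, prime_pi, theta.
  destruct (Req_dec x (INR (S n))) as [->|Hne].
  - rewrite !sum_primes_S.
    destruct (prime_dec (Z.of_nat (S n))); field; lra.
  - rewrite !(sum_primes_floor _ n x) by lra. reflexivity.
Qed.

(** On each [[n, n + 1]] the functions [prime_pi] and [theta] may be frozen, so
    that there [gap] has the derivative [(theta t - t) / (t * ln t ^ 2)]; by
    continuity the comparison extends across the integers. Stating it for
    [sigma * gap] covers increments of both signs at once. *)
Lemma gap_increment_le (sigma : R) (V v : R -> R) (y x : R) :
  1 < y -> y <= x ->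
  (forall t, y <= t <= x -> is_derive V t (v t)) ->
  (forall t, y <= t <= x ->
     sigma * ((theta t - t) / (t * ln t ^ 2)) <= v t) ->
  sigma * (gap x - gap y) <= V x - V y.
Proof.
  intros Hy Hyx HV Hv.
  pose (f := fun t => V t - sigma * gap t).
  assert (Piece : forall (n : nat) s t, INR n <= s -> s <= t -> t <= INR (S n) ->
      y <= s -> t <= x -> f s <= f t).
  { intros n s t Hs Hst Ht Hys Htx. unfold f.
    rewrite !(gap_piece n) by lra.
    apply (nondecr_of_derive_nonneg
      (fun r => V r - sigma * (prime_pi (INR n) - Li r - (theta (INR n) - r) / ln r))
      (fun r => v r - sigma * ((theta (INR n) - r) / (r * ln r ^ 2)))); [exact Hst| |].
    - intros r Hr.
      assert (L := ln_pos r ltac:(lra)).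
      evar_last.
      { apply @is_derive_minus; [apply HV; lra|].
        apply @is_derive_scal, @is_derive_minus.
        - apply @is_derive_minus; [apply is_derive_const|apply is_derive_Li; lra].
        - auto_derive; [split; [lra|split; [lra|exact I]]|reflexivity]. }
      unfold minus, plus, opp, scal, zero; simpl. unfold mult; simpl. field. lra.
    - intros r Hr.
      assert (K := Hv r ltac:(lra)).
      unfold theta in K at 1. rewrite (sum_primes_floor _ n r) in K by lra.
      fold (theta (INR n)) in K. lra. }
  assert (Global : forall (n : nat) t, INR n <= t <= INR (S n) -> y <= t -> t <= x ->
      f y <= f t).
  { induction n as [|n IH]; intros t Ht Hyt Htx.
    - simpl in Ht. lra.
    - destruct (Rle_dec (INR (S n)) y) as [H|H].
      + apply (Piece (S n)); lra.
      + apply Rle_trans with (f (INR (S n))).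
        * destruct (Rle_dec (INR n) y) as [H'|H'].
          -- apply (Piece n); lra.
          -- apply IH; [rewrite S_INR|..]; lra.
        * apply (Piece (S n)); lra. }
  assert (H : f y <= f x).
  { destruct (nfloor_ex x) as [n Hn]; [lra|].
    apply (Global n); [rewrite S_INR|..]; lra. }
  unfold f in H. lra.
Qed.

(** * Numerical facts about the primes up to 32 *)

(** A primality test that reduces, so that the primes up to 32 are found by
    computation. *)
Definition primeb (n : nat) : bool :=
  Nat.ltb 1 n &&
  forallb (fun k => Z.eqb (Z.gcd (Z.of_nat k) (Z.of_nat n)) 1) (seq 1 (n - 1)).

Lemma primeb_spec (n : nat) : primeb n = true <-> prime (Z.of_nat n).
Proof.
  unfold primeb. rewrite andb_true_iff, Nat.ltb_lt, forallb_forall.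
  split.
  - intros [H1 H]. apply prime_intro; [lia|].
    intros m Hm. apply Zgcd_1_rel_prime.
    specialize (H (Z.to_nat m)). rewrite Z2Nat.id in H by lia.
    apply Z.eqb_eq, H, in_seq. lia.
  - intros Hp. assert (H2 := prime_ge_2 _ Hp). split; [lia|].
    intros k Hk. apply in_seq in Hk. apply Z.eqb_eq, Zgcd_1_rel_prime.
    apply rel_prime_le_prime; [exact Hp|lia].
Qed.

Lemma sum_primes_S_primeb (f : R -> R) (n : nat) :
  sum_primes f (INR (S n)) =
  sum_primes f (INR n) + if primeb (S n) then f (INR (S n)) else 0.
Proof.
  rewrite sum_primes_S. f_equal.
  generalize (primeb_spec (S n)).
  destruct (prime_dec (Z.of_nat (S n))) as [H|H], (primeb (S n)); intros E;
    try reflexivity.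
  - apply E in H. discriminate.
  - destruct H. apply E. reflexivity.
Qed.

Lemma sum_primes_0 (f : R -> R) : sum_primes f (INR 0) = 0.
Proof.
  unfold sum_primes.
  rewrite <- (Int_part_spec (INR 0) 0) by (simpl; lra).
  simpl. rewrite sum_O.
  destruct (prime_dec (Z.of_nat 0)) as [H|H]; [|reflexivity].
  apply prime_ge_2 in H. simpl in H. lia.
Qed.

Fixpoint primorial (n : nat) : Z :=
  match n with
  | O => 1
  | S m => if primeb (S m) then primorial m * Z.of_nat (S m) else primorial m
  end.

Fixpoint prime_count (n : nat) : Z :=
  match n with
  | O => 0
  | S m => if primeb (S m) then prime_count m + 1 else prime_count m
  end.

Lemma primorial_pos (n : nat) : (0 < primorial n)%Z.
Proof.
  induction n as [|n IH]; [reflexivity|].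
  cbn [primorial]. destruct (primeb (S n)); lia.
Qed.

Lemma theta_primorial (n : nat) : theta (INR n) = ln (IZR (primorial n)).
Proof.
  induction n as [|n IH]; unfold theta.
  - rewrite sum_primes_0. symmetry. exact ln_1.
  - rewrite sum_primes_S_primeb. fold (theta (INR n)). rewrite IH.
    cbn [primorial]. destruct (primeb (S n)); [|apply Rplus_0_r].
    rewrite mult_IZR, ln_mult, <- INR_IZR_INZ; [reflexivity| |].
    + apply IZR_lt, primorial_pos.
    + apply IZR_lt. lia.
Qed.

Lemma prime_pi_count (n : nat) : prime_pi (INR n) = IZR (prime_count n).
Proof.
  induction n as [|n IH]; unfold prime_pi.
  - exact (sum_primes_0 _).
  - rewrite sum_primes_S_primeb. fold (prime_pi (INR n)). rewrite IH.
    cbn [prime_count]. destruct (primeb (S n)); [|apply Rplus_0_r].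
    rewrite plus_IZR. reflexivity.
Qed.

Lemma ln_pow_IZR (z : Z) (k : nat) :
  (0 < z)%Z -> ln (IZR (z ^ Z.of_nat k)) = INR k * ln (IZR z).
Proof.
  intros Hz. rewrite <- pow_IZR, ln_pow; [reflexivity|]. apply IZR_lt, Hz.
Qed.

Lemma ln2_bounds : 6922 / 10000 <= ln 2 <= 7 / 10.
Proof.
  split.
  - (* [ln 2 = ln 16 - ln 8], in eight steps for accuracy. *)
    assert (P := fun k => ln_sub_ge_pade (IZR k) (IZR (k + 1))).
    assert (E8 : ln 8 = 3 * ln 2).
    { change 8 with (IZR (2 ^ Z.of_nat 3)). rewrite ln_pow_IZR by lia. simpl; ring. }
    assert (E16 : ln 16 = 4 * ln 2).
    { change 16 with (IZR (2 ^ Z.of_nat 4)). rewrite ln_pow_IZR by lia. simpl; ring. }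
    assert (H8 := P 8%Z ltac:(lra) ltac:(simpl; lra)).
    assert (H9 := P 9%Z ltac:(lra) ltac:(simpl; lra)).
    assert (H10 := P 10%Z ltac:(lra) ltac:(simpl; lra)).
    assert (H11 := P 11%Z ltac:(lra) ltac:(simpl; lra)).
    assert (H12 := P 12%Z ltac:(lra) ltac:(simpl; lra)).
    assert (H13 := P 13%Z ltac:(lra) ltac:(simpl; lra)).
    assert (H14 := P 14%Z ltac:(lra) ltac:(simpl; lra)).
    assert (H15 := P 15%Z ltac:(lra) ltac:(simpl; lra)).
    simpl in *. lra.
  - rewrite <- (ln_exp (7 / 10)). apply ln_le; [lra|].
    assert (H := exp_ge_cubic (7 / 10)). lra.
Qed.

Lemma ln3_bounds : 1096 / 1000 <= ln 3 <= 113 / 100.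
Proof.
  assert (L := ln2_bounds). split.
  - assert (E4 : ln 4 = 2 * ln 2).
    { replace 4 with (2 * 2) by lra. rewrite ln_mult; lra. }
    assert (E6 : ln 6 = ln 2 + ln 3).
    { replace 6 with (2 * 3) by lra. rewrite ln_mult; lra. }
    assert (H4 := ln_sub_ge_pade 4 5 ltac:(lra) ltac:(lra)).
    assert (H5 := ln_sub_ge_pade 5 6 ltac:(lra) ltac:(lra)).
    lra.
  - rewrite <- (ln_exp (113 / 100)). apply ln_le; [lra|].
    assert (H := exp_ge_cubic (113 / 100)). lra.
Qed.

(** The product of the primes up to [n <= 32] is at most [2 ^ (10 * n / 7)], and
    [ln 2 <= 7 / 10]. *)
Lemma theta_le_small (t : R) : 1 < t <= 32 -> theta t <= t.
Proof.
  intros Ht. destruct (nfloor_ex t) as [n Hn]; [lra|].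
  unfold theta. rewrite (sum_primes_floor _ n) by (rewrite S_INR; lra).
  fold (theta (INR n)). apply Rle_trans with (INR n); [|lra].
  assert (Hn32 : (n < 33)%nat).
  { apply INR_lt. replace (INR 33) with 33 by (simpl; lra). lra. }
  rewrite theta_primorial.
  set (k := (10 * n / 7)%nat).
  apply Rle_trans with (ln (IZR (2 ^ Z.of_nat k))).
  - apply ln_le; [apply IZR_lt, primorial_pos|]. apply IZR_le.
    assert (C : forallb (fun n => Z.leb (primorial n) (2 ^ Z.of_nat (10 * n / 7)))
                        (seq 0 33) = true) by (vm_compute; reflexivity).
    rewrite forallb_forall in C. apply Z.leb_le, (C n), in_seq. lia.
  - rewrite ln_pow_IZR by lia.
    assert (L := ln2_bounds).
    assert (Hk : 7 * INR k <= 10 * INR n).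
    { replace 7 with (INR 7) by (simpl; lra). replace 10 with (INR 10) by (simpl; lra).
      rewrite <- !mult_INR. apply le_INR. unfold k.
      apply Nat.Div0.mul_div_le. }
    assert (K := pos_INR k). nra.
Qed.

(** The right-hand side is what comes from replacing the convex function [1 / z]
    of [z = ln r] by its chord between [ln t] and [ln x]. It is also integration by
    parts, the last term standing for the integral of [1 / ln r ^ 2]. *)
Lemma Li_increment_le (t x : R) :
  1 < t -> t <= x ->
  Li x - Li t <= x / ln x - t / ln t + (x - t) / (ln t * ln x).
Proof.
  intros Ht Htx.
  assert (Lt := ln_pos t Ht).
  pose (f := fun r => r / ln r + (r - t) / (ln t * ln r) - Li r).
  assert (H : f t <= f x).
  { apply (nondecr_of_derive_nonneg f
      (fun r => (ln r - ln t - (1 - t / r)) / (ln t * ln r ^ 2))); [exact Htx| |].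
    - intros r Hr. unfold f.
      assert (L := ln_pos r ltac:(lra)).
      evar_last.
      { apply @is_derive_minus; [|apply is_derive_Li; lra].
        auto_derive; [|reflexivity].
        repeat split; try lra. apply Rgt_not_eq, Rmult_lt_0_compat; lra. }
      unfold minus, plus, opp; simpl. field. lra.
    - intros r Hr.
      assert (L := ln_pos r ltac:(lra)).
      apply Rle_div_r; [apply Rmult_lt_0_compat; nra|].
      assert (K := ln_le_sub_one (t / r) ltac:(apply Rdiv_lt_0_compat; lra)).
      rewrite ln_div in K by lra. lra. }
  unfold f in H. replace (t - t) with 0 in H by ring.
  unfold Rdiv at 2 in H. rewrite Rmult_0_l in H. lra.
Qed.

(** The value is about 0.16. The integral is cut at numbers without prime factors
    beyond 3, so that [ln 2] and [ln 3] are the only logarithms to estimate; this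
    cut costs about 0.09. *)
Lemma gap_32_nonneg : 0 <= gap 32.
Proof.
  assert (L := ln2_bounds). assert (M := ln3_bounds).
  set (l := ln 2) in *. set (m := ln 3) in *.
  assert (E4 : ln 4 = 2 * l) by
    (replace 4 with (2 * 2) by lra; rewrite ln_mult; unfold l; lra).
  assert (E6 : ln 6 = l + m) by
    (replace 6 with (2 * 3) by lra; rewrite ln_mult; unfold l, m; lra).
  assert (E8 : ln 8 = 3 * l) by
    (replace 8 with (2 * 4) by lra; rewrite ln_mult; unfold l in *; lra).
  assert (E12 : ln 12 = 2 * l + m) by
    (replace 12 with (2 * 6) by lra; rewrite ln_mult; unfold l, m in *; lra).
  assert (E16 : ln 16 = 4 * l) by
    (replace 16 with (2 * 8) by lra; rewrite ln_mult; unfold l in *; lra).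
  assert (E24 : ln 24 = 3 * l + m) by
    (replace 24 with (2 * 12) by lra; rewrite ln_mult; unfold l, m in *; lra).
  assert (E32 : ln 32 = 5 * l) by
    (replace 32 with (2 * 16) by lra; rewrite ln_mult; unfold l in *; lra).
  assert (H2 := Li_increment_le 2 3 ltac:(lra) ltac:(lra)).
  assert (H3 := Li_increment_le 3 4 ltac:(lra) ltac:(lra)).
  assert (H4 := Li_increment_le 4 6 ltac:(lra) ltac:(lra)).
  assert (H6 := Li_increment_le 6 8 ltac:(lra) ltac:(lra)).
  assert (H8 := Li_increment_le 8 12 ltac:(lra) ltac:(lra)).
  assert (H12 := Li_increment_le 12 16 ltac:(lra) ltac:(lra)).
  assert (H16 := Li_increment_le 16 24 ltac:(lra) ltac:(lra)).
  assert (H24 := Li_increment_le 24 32 ltac:(lra) ltac:(lra)).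
  fold l m in H2, H3.
  rewrite ?E4, ?E6, ?E8, ?E12, ?E16, ?E24, ?E32 in *.
  assert (HLi2 : Li 2 = 0) by exact (RInt_point (V := R_CompleteNormedModule) 2 _).
  assert (Hpi : prime_pi 32 = 11).
  { replace 32 with (INR 32) by (simpl; lra).
    rewrite prime_pi_count. f_equal; try (vm_compute; reflexivity). }
  (* The product of the primes up to 31 is 200560490130, just below 3 * 2 ^ 36. *)
  assert (Hth : theta 32 <= 36 * l + m).
  { replace 32 with (INR 32) by (simpl; lra). rewrite theta_primorial.
    replace (36 * l + m) with (ln (IZR (2 ^ Z.of_nat 36 * 3))).
    - apply ln_le; [apply IZR_lt, primorial_pos|].
      apply IZR_le. vm_compute. discriminate.
    - rewrite mult_IZR, ln_mult, ln_pow_IZR by (try lia; apply IZR_lt; lia).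
      fold l m. replace (INR 36) with 36 by (simpl; lra). reflexivity. }
  assert (Hsum : Li 32 <= 32 / (5 * l) - 2 / l
     + (3 / 2 / m + 5 / 3 / (l + m) + 7 / 3 / (2 * l + m) + 18 / 5 / (3 * l + m)) / l).
  { replace ((3 / 2 / m + 5 / 3 / (l + m) + 7 / 3 / (2 * l + m) + 18 / 5 / (3 * l + m)) / l)
      with ((3 - 2) / (l * m) + (4 - 3) / (m * (2 * l)) + (6 - 4) / (2 * l * (l + m))
        + (8 - 6) / ((l + m) * (3 * l)) + (12 - 8) / (3 * l * (2 * l + m))
        + (16 - 12) / ((2 * l + m) * (4 * l)) + (24 - 16) / (4 * l * (3 * l + m))
        + (32 - 24) / ((3 * l + m) * (5 * l))) by (field; lra).
    lra. }
  unfold gap. rewrite Hpi, E32.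
  assert (I1 : / m <= / (1096 / 1000)) by (apply Rinv_le_contravar; lra).
  assert (I2 : / (l + m) <= / (17882 / 10000)) by (apply Rinv_le_contravar; lra).
  assert (I3 : / (2 * l + m) <= / (24804 / 10000)) by (apply Rinv_le_contravar; lra).
  assert (I4 : / (3 * l + m) <= / (31726 / 10000)) by (apply Rinv_le_contravar; lra).
  set (S := 3 / 2 / m + 5 / 3 / (l + m) + 7 / 3 / (2 * l + m) + 18 / 5 / (3 * l + m)) in *.
  assert (HS : S <= 19 / 5 * l - m / 5 + 2) by (unfold S; lra).
  apply Rle_trans with ((19 / 5 * l - m / 5 + 2 - S) / l).
  - apply Rle_div_r; lra.
  - apply Rle_trans with
      (11 - (32 / (5 * l) - 2 / l + S / l) - (36 * l + m - 32) / (5 * l)).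
    + right. field. lra.
    + assert (Hd : (theta 32 - 32) / (5 * l) <= (36 * l + m - 32) / (5 * l)).
      { apply Rmult_le_compat_r; [left; apply Rinv_0_lt_compat; lra|lra]. }
      lra.
Qed.

(** Below 32 one has [theta t <= t], so the derivative of [gap] is nonpositive. *)
Lemma gap_decr_small (y x : R) :
  1 < y -> y <= x -> x <= 32 -> gap x <= gap y.
Proof.
  intros Hy Hyx Hx.
  assert (H : 1 * (gap x - gap y) <= 0 - 0).
  { apply (gap_increment_le 1 (fun _ => 0) (fun _ => 0)); [exact Hy|exact Hyx| |].
    - intros; apply @is_derive_const.
    - intros t Ht. rewrite Rmult_1_l.
      assert (T := theta_le_small t ltac:(lra)).
      assert (L := ln_pos t ltac:(lra)).
      apply Rle_div_l; [apply Rmult_lt_0_compat; nra|]. lra. }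
  lra.
Qed.

(** * Comparison of [gap] with the Dawson integral *)

(** The error bound in the variable [s = sqrt (ln t)]; the exponent is written
    [p + 3] because [p] is the exponent left in the weight. *)
Definition E_theta_bounded (N a p y x : R) : Prop :=
  forall t, y <= t <= x ->
  E_theta t <= N * Rpower (sqrt (ln t)) (p + 3) * exp (-2 * a * sqrt (ln t)).

(** In the variable [s = sqrt (ln t)] the error bound becomes the weight
    [s ^ p * exp ((s - a) ^ 2)], so any primitive of a majorant of this weight
    controls the increments of [gap]. *)
Lemma gap_increment_weight (N a p y x : R) (F f : R -> R) :
  0 <= N -> 1 < y -> y <= x ->
  E_theta_bounded N a p y x ->
  (forall s, sqrt (ln y) <= s <= sqrt (ln x) -> is_derive F s (f s)) ->
  (forall s, sqrt (ln y) <= s <= sqrt (ln x) ->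
     Rpower s p * exp ((s - a) ^ 2) <= f s) ->
  Rabs (gap x - gap y) <=
  2 * N * exp (- a ^ 2) * (F (sqrt (ln x)) - F (sqrt (ln y))).
Proof.
  intros HN Hy Hyx HE HF Hf.
  set (K := 2 * N * exp (- a ^ 2)).
  assert (HK : 0 <= K)
    by (unfold K; assert (P := exp_pos (- a ^ 2)); apply Rmult_le_pos; lra).
  pose (v := fun t => K * (/ t * / (2 * sqrt (ln t)) * f (sqrt (ln t)))).
  assert (Hs : forall t, y <= t <= x -> sqrt (ln y) <= sqrt (ln t) <= sqrt (ln x)).
  { intros t Ht. split; apply sqrt_le_1_alt, ln_le; lra. }
  assert (HV : forall t, y <= t <= x ->
    is_derive (fun t => K * F (sqrt (ln t))) t (v t)).
  { intros t Ht. assert (L := ln_pos t ltac:(lra)).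
    apply @is_derive_scal.
    apply (is_derive_comp F (fun t => sqrt (ln t))); [apply HF, Hs, Ht|].
    auto_derive; [lra|]. field.
    split; [apply Rgt_not_eq, sqrt_lt_R0; lra|lra]. }
  assert (Hv : forall t, y <= t <= x -> Rabs ((theta t - t) / (t * ln t ^ 2)) <= v t).
  { intros t Ht. assert (L := ln_pos t ltac:(lra)).
    assert (Hst := Hf _ (Hs t Ht)). assert (HEt := HE t Ht).
    unfold E_theta in HEt. unfold v.
    set (s := sqrt (ln t)) in *.
    assert (Ps : 0 < s) by (apply sqrt_lt_R0; lra).
    assert (Es : ln t = s ^ 2) by (unfold s; rewrite pow2_sqrt; lra).
    assert (Et : exp (- a ^ 2) * exp ((s - a) ^ 2) = t * exp (-2 * a * s)).
    { rewrite <- (exp_ln t) by lra. rewrite Es, <- !exp_plus. f_equal. ring. }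
    assert (Ep : Rpower s (p + 3) = Rpower s p * s ^ 3).
    { rewrite Rpower_plus. f_equal.
      replace 3 with (INR 3) by (simpl; lra). apply Rpower_pow, Ps. }
    replace ((theta t - t) / (t * ln t ^ 2)) with ((theta t - t) / t * / s ^ 4)
      by (rewrite Es; field; lra).
    assert (P4 : 0 < / s ^ 4) by (apply Rinv_0_lt_compat, pow_lt, Ps).
    rewrite Rabs_mult, (Rabs_pos_eq (/ s ^ 4)) by lra.
    apply Rle_trans with (N * Rpower s (p + 3) * exp (-2 * a * s) * / s ^ 4).
    { apply Rmult_le_compat_r; lra. }
    apply Rle_trans with
      (K * (/ t * / (2 * s) * (Rpower s p * exp ((s - a) ^ 2)))).
    - right. unfold K. rewrite Ep.
      replace (2 * N * exp (- a ^ 2) *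
        (/ t * / (2 * s) * (Rpower s p * exp ((s - a) ^ 2))))
        with (N * Rpower s p * (exp (- a ^ 2) * exp ((s - a) ^ 2)) * / t * / s)
        by (field; lra).
      rewrite Et. field. lra.
    - apply Rmult_le_compat_l; [exact HK|].
      apply Rmult_le_compat_l; [|exact Hst].
      left. apply Rmult_lt_0_compat; apply Rinv_0_lt_compat; lra. }
  assert (G : forall sigma, sigma = 1 \/ sigma = -1 ->
    sigma * (gap x - gap y) <= K * (F (sqrt (ln x)) - F (sqrt (ln y)))).
  { intros sigma Hsig. rewrite (Rmult_minus_distr_l K).
    apply (gap_increment_le sigma (fun t => K * F (sqrt (ln t))) v);
      [exact Hy|exact Hyx|exact HV|].
    intros t Ht. apply Rle_trans with (2 := Hv t Ht).
    destruct Hsig as [->| ->].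
    - rewrite Rmult_1_l. apply Rle_abs.
    - rewrite <- Rabs_Ropp. eapply Rle_trans; [|apply Rle_abs]. lra. }
  assert (G1 := G 1 (or_introl eq_refl)). assert (G2 := G (-1) (or_intror eq_refl)).
  apply Rabs_le. lra.
Qed.

(** To the left of the minimum of [(s - a) ^ 2] the factor [s ^ p] more than
    makes up for the growth of the exponential, because [p >= a ^ 2 / 2 - 1]. *)
Lemma weight_le_exp (a b p s : R) :
  2 <= b ^ 2 -> 0 < b -> b <= s -> s <= a -> a ^ 2 / 2 - 1 <= p ->
  Rpower s p * exp ((s - a) ^ 2) <=
  Rpower a p * exp (- ((b ^ 2 - 2) / (a + b) * (a - s))).
Proof.
  intros Hb2 Hb Hs Hsa Hp.
  unfold Rpower. rewrite <- !exp_plus.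
  assert (L := ln_sub_ge_pade s a ltac:(lra) Hsa).
  assert (Lp : (a ^ 2 / 2 - 1) * (2 * (a - s) / (a + s)) <= p * (ln a - ln s)).
  { assert (b ^ 2 <= a ^ 2) by (apply pow_incr; lra).
    apply Rmult_le_compat; [lra| |exact Hp|exact L].
    apply Rle_div_r; [lra|]. lra. }
  assert (Q : (b ^ 2 - 2) / (a + b) <= (s ^ 2 - 2) / (a + s)).
  { apply Rle_div_l; [lra|].
    replace ((s ^ 2 - 2) / (a + s) * (a + b))
      with ((s ^ 2 - 2) * (a + b) / (a + s)) by (field; lra).
    apply Rle_div_r; [lra|].
    assert (0 <= (s - b) * (a * (s + b) + s * b + 2)) by (apply Rmult_le_pos; nra).
    lra. }
  assert (E : (a ^ 2 / 2 - 1) * (2 * (a - s) / (a + s)) =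
              (s - a) ^ 2 + (s ^ 2 - 2) / (a + s) * (a - s)) by (field; lra).
  assert (Q' := Rmult_le_compat_r (a - s) _ _ ltac:(lra) Q).
  assert (X : p * ln s + (s - a) ^ 2 <=
              p * ln a + - ((b ^ 2 - 2) / (a + b) * (a - s))) by lra.
  apply exp_le, X.
Qed.

(** The left-hand side bounds the integral of [exp (- k * (a - s))] over [[b, a]],
    with [k = (b ^ 2 - 2) / (a + b)]; the polynomial on the right is a lower bound
    for [exp w - 1]. Clearing denominators leaves a polynomial inequality whose
    margin is only about two percent near [a = 2.75]. *)
Lemma loss_le_taylor (a : R) (b := 93 / 50) (w := (a ^ 2 - 2) / (2 * a + 1)) :
  b <= a ->
  2 * (a - b) / (2 + (b ^ 2 - 2) / (a + b) * (a - b)) <=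
  3 / 5 * (w + w ^ 2 / 2 + w ^ 3 / 6).
Proof.
  intros Ha. unfold w, b in *. clear w b.
  set (z := a - 93 / 50). assert (Hz : 0 <= z) by (unfold z; lra).
  replace a with (z + 93 / 50) by (unfold z; ring). clearbody z. clear Ha a.
  set (D := 2 * (z + 93 / 50) + 1).
  set (n := (z + 93 / 50) ^ 2 - 2).
  set (q := (93 / 50) ^ 2 * (z + 93 / 50) + (4 - (93 / 50) ^ 2) * (93 / 50)).
  assert (HD : 0 < D) by (unfold D; lra).
  assert (Hq : 0 < q) by (unfold q; lra).
  replace (2 + ((93 / 50) ^ 2 - 2) / (z + 93 / 50 + 93 / 50) * z)
    with (q / (z + 93 / 25)) by (unfold q; field; lra).
  replace (2 * z / (q / (z + 93 / 25)))
    with (2 * z * (z + 93 / 25) / q) by (field; lra).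
  replace (3 / 5 * (n / D + (n / D) ^ 2 / 2 + (n / D) ^ 3 / 6))
    with ((n * D ^ 2 / 10 * 6 + n ^ 2 * D / 10 * 3 + n ^ 3 / 10) / D ^ 3)
    by (field; lra).
  apply Rle_div_l; [exact Hq|].
  replace ((n * D ^ 2 / 10 * 6 + n ^ 2 * D / 10 * 3 + n ^ 3 / 10) / D ^ 3 * q)
    with ((n * D ^ 2 / 10 * 6 + n ^ 2 * D / 10 * 3 + n ^ 3 / 10) * q / D ^ 3)
    by (field; lra).
  apply (Rle_div_r _ _ (D ^ 3)); [apply pow_lt, HD|].
  (* Squares vanishing near the near-equality point [z = 0.9]. *)
  assert (S1 : 0 <= z ^ 3 * (z - 9 / 10) ^ 2)
    by (apply Rmult_le_pos; [apply pow_le, Hz|apply pow2_ge_0]).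
  assert (S2 : 0 <= z ^ 2 * (z - 9 / 10) ^ 2)
    by (apply Rmult_le_pos; apply pow2_ge_0).
  assert (S3 : 0 <= (z - 9 / 10) ^ 2) by apply pow2_ge_0.
  assert (S4 : 0 <= (z ^ 2 - 4 / 5) ^ 2) by apply pow2_ge_0.
  assert (Z6 : 0 <= z ^ 6) by (apply pow_le, Hz).
  assert (Z7 : 0 <= z ^ 7) by (apply pow_le, Hz).
  unfold n, D, q. lra.
Qed.

(** The loss is the integral of the weight over [[b, a]]. The gain is what the
    bound [s ^ p <= (1 + a) ^ p] wastes on [[a, 1 + a]]: if [s ^ p] lies below a
    line of relative slope [tau], this is at least [tau] times the integral of
    [(1 - v) * exp (v ^ 2)] over [[0, 1]], which exceeds 3/5. The line is the chord
    for [p >= 1] and the tangent at [1 + a] for [p <= 1]; in the second case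
    [a <= 2] is so close to [b] that crude bounds do. *)
Lemma loss_le_gain (a p : R) (b := 93 / 50) :
  b <= a -> a ^ 2 / 2 - 1 <= p ->
  exists tau, 0 <= tau /\
    (forall s, a <= s <= 1 + a ->
       Rpower s p <= Rpower (1 + a) p * (1 - (1 + a - s) * tau)) /\
    Rpower a p * (2 * (a - b) / (2 + (b ^ 2 - 2) / (a + b) * (a - b))) <=
    Rpower (1 + a) p * (3 / 5 * tau).
Proof.
  intros Ha Hp.
  assert (Ha' : 93 / 50 <= a) by exact Ha.
  assert (La := loss_le_taylor a Ha). cbv zeta in La. fold b in La.
  set (loss := 2 * (a - b) / (2 + (b ^ 2 - 2) / (a + b) * (a - b))) in *.
  assert (Ea : Rpower a p = Rpower (1 + a) p * Rpower (a / (1 + a)) p).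
  { rewrite Rpower_mult_distr; [|lra|apply Rdiv_lt_0_compat; lra].
    f_equal. field. lra. }
  destruct (Rle_dec 1 p) as [H1|H1].
  - (* The gain relative to the loss is governed by
       [((1 + a) / a) ^ p >= exp ((a ^ 2 - 2) / (2 * a + 1))]. *)
    assert (Hr : Rpower (a / (1 + a)) p * exp ((a ^ 2 - 2) / (2 * a + 1)) <= 1).
    { unfold Rpower. rewrite <- exp_plus.
      apply Rle_trans with (exp 0); [|rewrite exp_0; lra].
      assert (X : p * ln (a / (1 + a)) + (a ^ 2 - 2) / (2 * a + 1) <= 0).
      { rewrite ln_div by lra.
        assert (L := ln_sub_ge_pade a (1 + a) ltac:(lra) ltac:(lra)).
        assert (K : (a ^ 2 / 2 - 1) * (2 * (1 + a - a) / (1 + a + a)) <=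
                    p * (ln (1 + a) - ln a)).
        { apply Rmult_le_compat; [nra| |exact Hp|exact L].
          apply Rle_div_r; lra. }
        replace ((a ^ 2 / 2 - 1) * (2 * (1 + a - a) / (1 + a + a)))
          with ((a ^ 2 - 2) / (2 * a + 1)) in K by (field; lra). lra. }
      apply exp_le, X. }
    assert (Hw : 0 <= (a ^ 2 - 2) / (2 * a + 1)) by (apply Rle_div_r; nra).
    assert (T := exp_ge_cubic _ Hw).
    set (w := (a ^ 2 - 2) / (2 * a + 1)) in *.
    assert (Hr0 := Rpower_ge_0 (a / (1 + a)) p).
    set (r := Rpower (a / (1 + a)) p) in *.
    assert (Hrt : r * (w + w ^ 2 / 2 + w ^ 3 / 6) <= 1 - r) by nra.
    assert (0 <= r * (w + w ^ 2 / 2 + w ^ 3 / 6)).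
    { apply Rmult_le_pos; [exact Hr0|].
      assert (0 <= w ^ 2) by (apply pow_le, Hw).
      assert (0 <= w ^ 3) by (apply pow_le, Hw). lra. }
    exists (1 - r). split; [lra|split].
    + intros s Hs.
      assert (C := Rpower_le_chord a (1 + a) s p ltac:(lra) Hs ltac:(lra) H1).
      replace ((1 + a - s) / (1 + a - a)) with (1 + a - s) in C by (field; lra).
      exact C.
    + rewrite Ea. fold r. rewrite Rmult_assoc.
      apply Rmult_le_compat_l; [apply Rpower_ge_0|].
      assert (r * loss <= r * (3 / 5 * (w + w ^ 2 / 2 + w ^ 3 / 6)))
        by (apply Rmult_le_compat_l; assumption).
      lra.
  - apply Rnot_le_lt in H1.
    assert (Ha2 : a <= 2) by (apply Rnot_lt_le; intros H2;
      assert (2 ^ 2 <= a ^ 2) by (apply pow_incr; lra); lra).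
    exists (p / (1 + a)).
    assert (Hsq : (93 / 50) ^ 2 <= a ^ 2) by (apply pow_incr; lra).
    assert (Hp0 : 7298 / 10000 <= p) by lra.
    assert (Ht : 243 / 1000 <= p / (1 + a)) by (apply (Rle_div_r _ _ (1 + a)); lra).
    split; [lra|split].
    + intros s Hs. apply Rpower_le_tangent; lra.
    + apply Rmult_le_compat; [apply Rpower_ge_0| | |].
      * unfold loss, b. apply Rle_div_r; [|lra].
        apply Rplus_lt_le_0_compat; [lra|].
        apply Rmult_le_pos; [apply Rle_div_r|]; lra.
      * apply Rle_Rpower_l; lra.
      * apply Rle_trans with (a - b); [|unfold b; lra].
        unfold loss, b. apply Rle_div_l.
        -- apply Rplus_lt_le_0_compat; [lra|].
           apply Rmult_le_pos; [apply Rle_div_r|]; lra.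
        -- assert (0 <= ((93 / 50) ^ 2 - 2) / (a + 93 / 50) * (a - 93 / 50)).
           { apply Rmult_le_pos; [apply Rle_div_r|]; lra. }
           nra.
Qed.

Lemma is_derive_weight_exp (c k a s : R) :
  k <> 0 ->
  is_derive (fun s => c * (exp (- (k * (a - s))) / k)) s (c * exp (- (k * (a - s)))).
Proof. intros Hk. auto_derive; [exact I|]. unfold Rminus. field. exact Hk. Qed.

Lemma is_derive_expsq_shift (a s : R) :
  is_derive (fun s => expsq_int (s - a)) s (exp ((s - a) ^ 2)).
Proof.
  evar_last.
  { apply (is_derive_comp expsq_int (fun s => s - a)); [apply is_derive_expsq_int|].
    auto_derive; [exact I|reflexivity]. }
  apply Rmult_1_l.
Qed.

Lemma sqrt_ln_exp_sq (s : R) : 0 <= s -> sqrt (ln (exp (s ^ 2))) = s.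
Proof. intros Hs. rewrite ln_exp. apply sqrt_pow2, Hs. Qed.

(** The derivative of [s ^ p * expsq_int (s - a)] is the weight plus a term that is
    nonnegative for [s >= a]. *)
Lemma gap_growth_right (N a p y x : R) :
  0 <= N -> 0 <= p -> 1 < y -> y <= x -> E_theta_bounded N a p y x -> a <= sqrt (ln y) ->
  Rabs (gap x - gap y) <=
  2 * N * exp (- a ^ 2) * (Rpower (sqrt (ln x)) p * expsq_int (sqrt (ln x) - a)
       - Rpower (sqrt (ln y)) p * expsq_int (sqrt (ln y) - a)).
Proof.
  intros HN Hp Hy Hyx HE Ha.
  assert (Py : 0 < sqrt (ln y)) by (apply sqrt_lt_R0, ln_pos, Hy).
  apply (gap_increment_weight N a p y x (fun s => Rpower s p * expsq_int (s - a))
    (fun s => p * Rpower s (p - 1) * expsq_int (s - a)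
              + Rpower s p * exp ((s - a) ^ 2))); [exact HN|exact Hy|exact Hyx|exact HE| |].
  - intros s Hs. 
    apply (is_derive_mult (fun s => Rpower s p) (fun s => expsq_int (s - a)));
      [apply is_derive_Rpower; lra|apply is_derive_expsq_shift|exact Rmult_comm].
  - intros s Hs.
    assert (0 <= p * Rpower s (p - 1) * expsq_int (s - a)).
    { apply Rmult_le_pos; [apply Rmult_le_pos; [exact Hp|apply Rpower_ge_0]|].
      apply expsq_int_nonneg. lra. }
    lra.
Qed.

(** The path is cut at [a] and [1 + a]: the loss before [a] is made up before
    [1 + a], and from there on [gap_growth_right] applies. *)
Lemma gap_growth_left (N a p y x : R) :
  0 <= N -> 0 <= p -> 1 < y -> y <= x -> E_theta_bounded N a p y x ->
  93 / 50 <= sqrt (ln y) -> sqrt (ln y) <= a -> 1 + a <= sqrt (ln x) ->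
  a ^ 2 / 2 - 1 <= p ->
  Rabs (gap x - gap y) <=
  2 * N * exp (- a ^ 2) * (Rpower (sqrt (ln x)) p * expsq_int (sqrt (ln x) - a)).
Proof.
  intros HN Hp Hy Hyx HE Hb Ha Hu Hpa.
  set (K := 2 * N * exp (- a ^ 2)).
  assert (HK : 0 <= K)
    by (unfold K; assert (P := exp_pos (- a ^ 2)); apply Rmult_le_pos; lra).
  assert (Ly := ln_pos y Hy).
  assert (Sq : forall t, 0 <= ln t -> ln t = sqrt (ln t) ^ 2)
    by (intros t Ht; rewrite pow2_sqrt; lra).
  assert (Lx : ln y <= ln x) by (apply ln_le; lra).
  set (y1 := exp (a ^ 2)). set (y2 := exp ((1 + a) ^ 2)).
  assert (S1 : sqrt (ln y1) = a) by (apply sqrt_ln_exp_sq; lra).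
  assert (S2 : sqrt (ln y2) = 1 + a) by (apply sqrt_ln_exp_sq; lra).
  assert (Hy1 : y <= y1).
  { rewrite <- (exp_ln y) by lra. unfold y1. apply exp_le.
    rewrite (Sq y) by lra. apply pow_incr. lra. }
  assert (Hy2 : y1 <= y2) by (apply exp_le; nra).
  assert (Hy3 : y2 <= x).
  { rewrite <- (exp_ln x) by lra. unfold y2. apply exp_le.
    rewrite (Sq x) by lra. apply pow_incr. lra. }
  destruct (loss_le_gain a p ltac:(lra) Hpa) as [tau [Ht [Hchord Hgain]]].
  set (b := 93 / 50) in *.
  set (k := (b ^ 2 - 2) / (a + b)) in *.
  assert (Hk : 0 < k) by (unfold k, b in *; apply Rdiv_lt_0_compat; lra).
  assert (I1 : Rabs (gap y1 - gap y) <= K * (Rpower a p * (2 * (a - b) / (2 + k * (a - b))))).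
  { eapply Rle_trans.
    - apply (gap_increment_weight N a p y y1
        (fun s => Rpower a p * (exp (- (k * (a - s))) / k))
        (fun s => Rpower a p * exp (- (k * (a - s))))); [exact HN|exact Hy|exact Hy1| | |].
      + intros t Ht1. apply HE. lra.
      + intros s Hs. apply is_derive_weight_exp. lra.
      + intros s Hs. rewrite S1 in Hs.
        apply weight_le_exp; unfold b in *; lra.
    - fold K. apply Rmult_le_compat_l; [exact HK|].
      rewrite S1, <- Rmult_minus_distr_l.
      apply Rmult_le_compat_l; [apply Rpower_ge_0|].
      set (d := a - sqrt (ln y)). assert (Hd : 0 <= d <= a - b) by (unfold d; lra).
      replace (k * (a - a)) with 0 by ring. rewrite Ropp_0, exp_0.
      replace (1 / k - exp (- (k * d)) / k) with ((1 - exp (- (k * d))) / k)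
        by (field; lra).
      assert (Hkd : 0 <= k * d) by (apply Rmult_le_pos; lra).
      assert (Hkb : k * d <= k * (a - b)) by (apply Rmult_le_compat_l; lra).
      apply Rle_div_l; [exact Hk|].
      apply Rle_trans with (1 := one_minus_exp_le_pade _ Hkd).
      apply Rle_div_l; [lra|].
      replace (2 * (a - b) / (2 + k * (a - b)) * k * (2 + k * d))
        with (2 * k * (a - b) * (2 + k * d) / (2 + k * (a - b))) by (field; lra).
      apply (Rle_div_r _ _ (2 + k * (a - b))); lra. }
  assert (I2 : Rabs (gap y2 - gap y1) <=
     K * (Rpower (1 + a) p * (expsq_int 1 - 3 / 5 * tau))).
  { eapply Rle_trans.
    - apply (gap_increment_weight N a p y1 y2
        (fun s => Rpower (1 + a) p *
           ((1 - tau) * expsq_int (s - a) + tau / 2 * exp ((s - a) ^ 2)))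
        (fun s => Rpower (1 + a) p *
           ((1 - tau) * exp ((s - a) ^ 2) + tau * (s - a) * exp ((s - a) ^ 2))));
        [exact HN|lra|exact Hy2| | |].
      + intros t Ht1. apply HE. lra.
      + intros s Hs. apply @is_derive_scal, @is_derive_plus.
        * apply @is_derive_scal, is_derive_expsq_shift.
        * auto_derive; [exact I|]. unfold Rminus. simpl. field.
      + intros s Hs. rewrite S1, S2 in Hs.
        assert (C := Hchord s ltac:(lra)).
        apply (Rmult_le_compat_r (exp ((s - a) ^ 2))) in C; [|left; apply exp_pos].
        lra.
    - fold K. apply Rmult_le_compat_l; [exact HK|].
      rewrite S1, S2, <- Rmult_minus_distr_l.
      apply Rmult_le_compat_l; [apply Rpower_ge_0|].
      replace (1 + a - a) with 1 by ring. replace (a - a) with 0 by ring.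
      rewrite expsq_int_0. replace (0 ^ 2) with 0 by ring. rewrite exp_0, pow1.
      assert (G := expsq_int_1_ge). nra. }
  assert (I3 := gap_growth_right N a p y2 x HN Hp ltac:(lra) Hy3
    ltac:(intros t Ht1; apply HE; lra) ltac:(lra)).
  fold K in I3. rewrite S2 in I3. replace (1 + a - a) with 1 in I3 by ring.
  assert (Hgain' := Rmult_le_compat_l K _ _ HK Hgain).
  replace (gap x - gap y)
    with ((gap x - gap y2) + ((gap y2 - gap y1) + (gap y1 - gap y))) by ring.
  eapply Rle_trans; [apply Rabs_triang|].
  eapply Rle_trans; [apply Rplus_le_compat_l, Rabs_triang|].
  lra.
Qed.

(** * From [gap] to [E_pi] *)

(** The start of the path is chosen so that one of [gap_growth_right] and
    [gap_growth_left] applies to it. *)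
Lemma gap_bound (N a p x0 x : R) :
  0 <= N -> 0 <= p -> a ^ 2 / 2 - 1 <= p -> 1 < x0 -> x0 <= x ->
  E_theta_bounded N a p x0 x -> 1 + a <= sqrt (ln x) ->
  Rabs (gap x) <= Rabs (gap x0) +
    2 * N * exp (- a ^ 2) * (Rpower (sqrt (ln x)) p * expsq_int (sqrt (ln x) - a)).
Proof.
  intros HN Hp Hpa Hx0 Hx HE Hu.
  assert (From : forall y, x0 <= y -> y <= x -> Rabs (gap y) <= Rabs (gap x0) ->
    a <= sqrt (ln y) \/ 93 / 50 <= sqrt (ln y) <= a ->
    Rabs (gap x) <= Rabs (gap x0) +
      2 * N * exp (- a ^ 2) *
        (Rpower (sqrt (ln x)) p * expsq_int (sqrt (ln x) - a))).
  { intros y Hy Hyx Hg Hcase.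
    replace (gap x) with (gap y + (gap x - gap y)) by ring.
    eapply Rle_trans; [apply Rabs_triang|]. apply Rplus_le_compat; [exact Hg|].
    assert (HE' : E_theta_bounded N a p y x) by (intros t Ht; apply HE; lra).
    destruct Hcase as [Ha|[Hb Ha]].
    - eapply Rle_trans; [apply (gap_growth_right N a p); try assumption; lra|].
      assert (0 <= 2 * N * exp (- a ^ 2) *
        (Rpower (sqrt (ln y)) p * expsq_int (sqrt (ln y) - a))); [|lra].
      apply Rmult_le_pos; [apply Rmult_le_pos; [lra|left; apply exp_pos]|].
      apply Rmult_le_pos; [apply Rpower_ge_0|apply expsq_int_nonneg; lra].
    - apply gap_growth_left; try assumption; lra. }
  assert (B32 : 93 / 50 <= sqrt (ln 32)).
  { rewrite <- (sqrt_pow2 (93 / 50)) by lra. apply sqrt_le_1_alt.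
    replace 32 with (IZR (2 ^ Z.of_nat 5)) by (simpl; lra).
    rewrite ln_pow_IZR by lia. assert (L := ln2_bounds). simpl. lra. }
  assert (Lx0 := ln_pos x0 Hx0).
  destruct (Rle_dec a (sqrt (ln x0))) as [Ha|Ha].
  { apply (From x0); [lra|exact Hx|lra|left; exact Ha]. }
  destruct (Rle_dec 32 x0) as [H32|H32].
  { apply (From x0); [lra|exact Hx|lra|right].
    split; [|lra]. apply Rle_trans with (1 := B32).
    apply sqrt_le_1_alt, ln_le; lra. }
  (* Below 32 the potential decreases and stays nonnegative, so that nothing is
     lost in starting again at the smaller of 32 and [exp (a ^ 2)]. *)
  assert (Ps : 0 <= sqrt (ln x0)) by apply sqrt_pos.
  assert (Ha0 : 0 <= a) by lra.
  assert (Hxa : x0 <= exp (a ^ 2)).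
  { rewrite <- (exp_ln x0) by lra. apply exp_le.
    rewrite <- (pow2_sqrt (ln x0)) by lra. apply pow_incr. lra. }
  assert (Hax : exp (a ^ 2) <= x).
  { assert (Lx : ln x0 <= ln x) by (apply ln_le; lra).
    rewrite <- (exp_ln x) by lra. apply exp_le.
    rewrite <- (pow2_sqrt (ln x)) by lra. apply pow_incr. lra. }
  assert (Small : forall y, x0 <= y -> y <= 32 -> Rabs (gap y) <= Rabs (gap x0)).
  { intros y Hy Hy32.
    assert (G1 := gap_decr_small x0 y Hx0 Hy Hy32).
    assert (G2 := gap_decr_small y 32 ltac:(lra) Hy32 ltac:(lra)).
    assert (G3 := gap_32_nonneg).
    rewrite !Rabs_pos_eq; lra. }
  destruct (Rle_dec 32 (exp (a ^ 2))) as [H|H].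
  - apply (From 32); [lra|lra|apply Small; lra|right].
    split; [exact B32|].
    rewrite <- (sqrt_ln_exp_sq a Ha0). apply sqrt_le_1_alt, ln_le; lra.
  - apply (From (exp (a ^ 2))); [exact Hxa|exact Hax|apply Small; lra|left].
    rewrite sqrt_ln_exp_sq; lra.
Qed.

(** Since [theta] is a step function; this excludes [A = 0]. *)
Lemma E_theta_not_null (x0 : R) : exists t, x0 <= t /\ 1 < t /\ 0 < E_theta t.
Proof.
  assert (P : forall t, 1 < t -> theta t <> t -> 0 < E_theta t).
  { intros t Ht Hne. apply Rabs_pos_lt. unfold Rdiv.
    apply Rmult_integral_contrapositive_currified; [lra|].
    apply Rinv_neq_0_compat. lra. }
  destruct (nfloor_ex (Rmax x0 1)) as [n Hn].
  { apply Rle_trans with 1; [lra|apply Rmax_r]. }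
  assert (M0 := Rmax_l x0 1). assert (M1 := Rmax_r x0 1).
  set (m := S n). assert (Hm : INR m = INR n + 1) by apply S_INR.
  assert (Hm' : INR (S m) = INR m + 1) by apply S_INR.
  (* [theta] takes the same value at [m] and at [m + 1 / 2]. *)
  destruct (Req_dec (theta (INR m)) (INR m)) as [E|E].
  - exists (INR m + 1 / 2). split; [lra|split; [lra|]].
    apply P; [lra|]. unfold theta.
    rewrite (sum_primes_floor _ m) by lra. fold (theta (INR m)). lra.
  - exists (INR m). split; [lra|split; [lra|]]. apply P; [lra|exact E].
Qed.

(** For [u = sqrt (ln x)] this is [x * eps_asymp x / ln x] up to a constant factor.
    The logarithmic derivative [q / u + 2 * u - 2 * a] is at least
    [2 * (u - a / 2) ^ 2 / u]. *)
Lemma main_term_incr (a q u u' : R) :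
  0 < u -> u <= u' -> a ^ 2 / 2 <= q ->
  Rpower u q * exp (u ^ 2 - 2 * a * u) <= Rpower u' q * exp (u' ^ 2 - 2 * a * u').
Proof.
  intros Hu Huu Hq. unfold Rpower. rewrite <- !exp_plus. apply exp_le.
  assert (L := ln_sub_ge_pade u u' Hu Huu).
  assert (K : a ^ 2 / 2 * (2 * (u' - u) / (u' + u)) <= q * (ln u' - ln u)).
  { apply Rmult_le_compat; [|apply Rle_div_r; lra|exact Hq|exact L].
    assert (0 <= a ^ 2) by apply pow2_ge_0. lra. }
  assert (S : 0 <= (u' - u) * (a - (u' + u)) ^ 2 / (u' + u)).
  { apply (Rle_div_r _ _ (u' + u)); [lra|]. rewrite Rmult_0_l.
    apply Rmult_le_pos; [lra|apply pow2_ge_0]. }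
  replace ((u' - u) * (a - (u' + u)) ^ 2 / (u' + u))
    with (a ^ 2 / 2 * (2 * (u' - u) / (u' + u)) + (u' ^ 2 - 2 * a * u')
          - (u ^ 2 - 2 * a * u)) in S by (field; lra).
  lra.
Qed.

Lemma eps_asymp_sqrt_ln (R0 A B c t : R) :
  0 < R0 -> 1 < t ->
  eps_asymp R0 A B c t =
  A / Rpower R0 B * Rpower (sqrt (ln t)) (2 * B - 3 + 3)
    * exp (-2 * (c / (2 * sqrt R0)) * sqrt (ln t)).
Proof.
  intros HR Ht. assert (L := ln_pos t Ht).
  assert (SR : 0 < sqrt R0) by (apply sqrt_lt_R0, HR).
  assert (SL : 0 < sqrt (ln t)) by (apply sqrt_lt_R0, L).
  unfold eps_asymp. rewrite sqrt_div_alt by exact HR.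
  replace (- c * (sqrt (ln t) / sqrt R0))
    with (-2 * (c / (2 * sqrt R0)) * sqrt (ln t)) by (field; lra).
  f_equal. unfold Rdiv at 2. rewrite Rmult_assoc. f_equal.
  unfold Rpower. rewrite ln_div by lra. rewrite <- exp_Ropp, <- exp_plus. f_equal.
  rewrite <- (pow2_sqrt (ln t)) at 1 by lra. rewrite ln_pow by exact SL.
  simpl. ring.
Qed.

Lemma E_pi_le_gap (x : R) :
  1 < x -> E_pi x <= E_theta x + ln x / x * Rabs (gap x).
Proof.
  intros Hx. assert (L := ln_pos x Hx).
  unfold E_pi, E_theta.
  replace ((prime_pi x - Li x) / (x / ln x))
    with ((theta x - x) / x + ln x / x * gap x) by (unfold gap; field; lra).
  eapply Rle_trans; [apply Rabs_triang|].
  rewrite Rabs_mult, (Rabs_pos_eq (ln x / x)); [lra|].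
  left. apply Rdiv_lt_0_compat; lra.
Qed.

Theorem theorem3 (zeta : C -> C) (Hzeta : is_riemann_zeta zeta)
  (R0 : R) (HR0 : 0 < R0) (Hfree : zero_free_region zeta R0)
  (A B c x0 x1 : R)
  (HB : Rmax (3 / 2) (1 + c ^ 2 / (16 * R0)) <= B)
  (Hx0 : 1 < x0)
  (Htheta : admissible_asymp E_theta R0 A B c x0)
  (Hx1 : Rmax x0 (exp ((1 + c / (2 * sqrt R0)) ^ 2)) <= x1) :
  (forall x : R, x1 <= x ->
     E_pi x <= eps_asymp R0 A B c x * (1 + mu_asymp R0 A B c x0 x1)) /\
  admissible_asymp E_pi R0 ((1 + mu_asymp R0 A B c x0 x1) * A) B c x1.
Proof.
  assert (Main : forall x : R, x1 <= x ->
     E_pi x <= eps_asymp R0 A B c x * (1 + mu_asymp R0 A B c x0 x1)).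
  2:{ split; [exact Main|]. intros x Hx. eapply Rle_trans; [apply Main, Hx|].
      right. unfold eps_asymp. ring. }
  intros x Hx.
  assert (SR : 0 < sqrt R0) by (apply sqrt_lt_R0, HR0).
  set (a := c / (2 * sqrt R0)) in *.
  set (N := A / Rpower R0 B).
  set (p := 2 * B - 3).
  assert (Heps : forall t, 1 < t -> eps_asymp R0 A B c t =
    N * Rpower (sqrt (ln t)) (p + 3) * exp (-2 * a * sqrt (ln t)))
    by (intros t Ht; apply eps_asymp_sqrt_ln; assumption).
  assert (Ea : a ^ 2 / 4 = c ^ 2 / (16 * R0)).
  { unfold a. rewrite <- (pow2_sqrt R0) at 2 by lra. field. lra. }
  assert (Hp : 0 <= p).
  { unfold p. assert (H := Rmax_l (3 / 2) (1 + c ^ 2 / (16 * R0))). lra. }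
  assert (Hpa : a ^ 2 / 2 - 1 <= p).
  { unfold p. assert (H := Rmax_r (3 / 2) (1 + c ^ 2 / (16 * R0))). lra. }
  assert (Hx01 := Rmax_l x0 (exp ((1 + a) ^ 2))).
  assert (Hax1 := Rmax_r x0 (exp ((1 + a) ^ 2))).
  assert (L0 := ln_pos x0 Hx0).
  assert (L1 := ln_pos x1 ltac:(lra)).
  assert (L := ln_pos x ltac:(lra)).
  assert (HN : 0 < N).
  { destruct (E_theta_not_null x0) as [t [Ht [Ht1 HtE]]].
    assert (Hb := Htheta t Ht). rewrite Heps in Hb by exact Ht1.
    assert (P1 : 0 < Rpower (sqrt (ln t)) (p + 3)) by apply exp_pos.
    assert (P2 := exp_pos (-2 * a * sqrt (ln t))).
    apply Rnot_le_lt. intros HN.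
    assert (0 <= - N * (Rpower (sqrt (ln t)) (p + 3) * exp (-2 * a * sqrt (ln t))))
      by (apply Rmult_le_pos; [lra|apply Rmult_le_pos; lra]).
    lra. }
  assert (Hu1 : 1 + a <= sqrt (ln x1)).
  { apply Rle_trans with (1 := Rle_abs _). rewrite <- sqrt_Rsqr_abs.
    apply sqrt_le_1_alt. rewrite Rsqr_pow2, <- (ln_exp ((1 + a) ^ 2)).
    apply ln_le; [apply exp_pos|lra]. }
  assert (Huu : sqrt (ln x1) <= sqrt (ln x)) by (apply sqrt_le_1_alt, ln_le; lra).
  assert (Hu1p : 0 < sqrt (ln x1)) by (apply sqrt_lt_R0, L1).
  assert (Hup : 0 < sqrt (ln x)) by lra.
  assert (HG := gap_bound N a p x0 x ltac:(lra) Hp Hpa Hx0 ltac:(lra)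
    ltac:(intros t Ht; rewrite <- Heps by lra; apply Htheta; lra) ltac:(lra)).
  assert (Hepsp : forall t, 1 < t -> 0 < eps_asymp R0 A B c t).
  { intros t Ht. rewrite Heps by exact Ht.
    apply Rmult_lt_0_compat; [apply Rmult_lt_0_compat|]; try apply exp_pos.
    exact HN. }
  assert (Hex := Hepsp x ltac:(lra)). assert (Hex1 := Hepsp x1 ltac:(lra)).
  assert (Sq : forall t, 1 < t -> ln t = sqrt (ln t) ^ 2).
  { intros t Ht. rewrite pow2_sqrt; [reflexivity|]. left; apply ln_pos, Ht. }
  assert (Pw : forall t k, 1 < t ->
    Rpower (sqrt (ln t)) (p + INR k) = Rpower (sqrt (ln t)) p * sqrt (ln t) ^ k).
  { intros t k Ht. rewrite Rpower_plus, Rpower_pow; [reflexivity|].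
    apply sqrt_lt_R0, ln_pos, Ht. }
  assert (Hmain : forall t, 1 < t -> t * eps_asymp R0 A B c t / ln t =
     N * (Rpower (sqrt (ln t)) (p + 1) * exp (sqrt (ln t) ^ 2 - 2 * a * sqrt (ln t)))).
  { intros t Ht. rewrite Heps by exact Ht.
    assert (Q3 := Pw t 3%nat Ht). assert (Q1 := Pw t 1%nat Ht).
    replace (INR 3) with 3 in Q3 by (simpl; lra). simpl (INR 1) in Q1.
    rewrite Q3, Q1.
    assert (S : 0 < sqrt (ln t)) by (apply sqrt_lt_R0, ln_pos, Ht).
    replace (sqrt (ln t) ^ 2 - 2 * a * sqrt (ln t))
      with (ln t + -2 * a * sqrt (ln t)) by (rewrite <- (Sq t Ht); ring).
    rewrite exp_plus, exp_ln by lra.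
    assert (Es := Sq t Ht). set (s := sqrt (ln t)) in *. rewrite Es.
    field. lra. }
  assert (Hmono : x1 * eps_asymp R0 A B c x1 / ln x1 <= x * eps_asymp R0 A B c x / ln x).
  { rewrite !Hmain by lra. apply Rmult_le_compat_l; [lra|].
    apply main_term_incr; lra. }
  assert (T1 : ln x / x * Rabs (gap x0) <= eps_asymp R0 A B c x *
    (x0 * ln x1 / (eps_asymp R0 A B c x1 * x1 * ln x0)
     * Rabs ((prime_pi x0 - Li x0) / (x0 / ln x0) - (theta x0 - x0) / x0))).
  { replace ((prime_pi x0 - Li x0) / (x0 / ln x0) - (theta x0 - x0) / x0)
      with (ln x0 / x0 * gap x0) by (unfold gap; field; lra).
    rewrite Rabs_mult, (Rabs_pos_eq (ln x0 / x0))
      by (left; apply Rdiv_lt_0_compat; lra).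
    set (e := eps_asymp R0 A B c x) in *. set (e1 := eps_asymp R0 A B c x1) in *.
    replace (e * (x0 * ln x1 / (e1 * x1 * ln x0) * (ln x0 / x0 * Rabs (gap x0))))
      with (e / (x1 * e1 / ln x1) * Rabs (gap x0)) by (field; lra).
    apply Rmult_le_compat_r; [apply Rabs_pos|].
    assert (P : 0 < x1 * e1 / ln x1).
    { apply Rdiv_lt_0_compat; [apply Rmult_lt_0_compat; lra|exact L1]. }
    apply (Rle_div_r _ _ (x1 * e1 / ln x1)); [exact P|].
    apply Rle_trans with (ln x / x * (x * e / ln x)).
    - apply Rmult_le_compat_l; [left; apply Rdiv_lt_0_compat; lra|exact Hmono].
    - right. field. lra. }
  assert (T2 : ln x / x * (2 * N * exp (- a ^ 2) *
      (Rpower (sqrt (ln x)) p * expsq_int (sqrt (ln x) - a)))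
    <= eps_asymp R0 A B c x * (2 * dawson (sqrt (ln x1) - a) / sqrt (ln x1))).
  { apply Rle_trans with
      (eps_asymp R0 A B c x * (2 * dawson (sqrt (ln x) - a) / sqrt (ln x))).
    - right. unfold dawson. fold (expsq_int (sqrt (ln x) - a)).
      rewrite Heps by lra.
      assert (Q3 := Pw x 3%nat ltac:(lra)).
      replace (INR 3) with 3 in Q3 by (simpl; lra). rewrite Q3.
      assert (Ex : / x * exp (- a ^ 2) =
        exp (-2 * a * sqrt (ln x)) * exp (- (sqrt (ln x) - a) ^ 2)).
      { rewrite <- (exp_ln x) at 1 by lra.
        rewrite <- exp_Ropp, <- !exp_plus. f_equal.
        rewrite (Sq x) at 1 by lra. ring. }
      transitivity (2 * N * ln x * (/ x * exp (- a ^ 2)) *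
        (Rpower (sqrt (ln x)) p * expsq_int (sqrt (ln x) - a))); [field; lra|].
      rewrite Ex. rewrite (Sq x) at 1 by lra. field. lra.
    - apply Rmult_le_compat_l; [lra|].
      apply Rle_div_l; [lra|].
      assert (D := dawson_decr (sqrt (ln x1) - a) (sqrt (ln x) - a)
        ltac:(lra) ltac:(lra)).
      assert (D0 : 0 <= dawson (sqrt (ln x1) - a)).
      { apply Rmult_le_pos; [left; apply exp_pos|].
        apply expsq_int_nonneg. lra. }
      set (d1 := dawson (sqrt (ln x1) - a)) in *.
      replace (2 * d1 / sqrt (ln x1) * sqrt (ln x))
        with (2 * d1 * (sqrt (ln x) / sqrt (ln x1))) by (field; lra).
      assert (1 <= sqrt (ln x) / sqrt (ln x1))
        by (apply (Rle_div_r _ _ (sqrt (ln x1))); lra).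
      nra. }
  assert (Hlx : 0 < ln x / x) by (apply Rdiv_lt_0_compat; lra).
  assert (HE := E_pi_le_gap x ltac:(lra)).
  assert (HEx := Htheta x ltac:(lra)).
  apply (Rmult_le_compat_l (ln x / x)) in HG; [|lra].
  unfold mu_asymp. fold a. lra.
Qed.
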